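(* Let $R$ be a commutative noetherian ring and suppose that $M$ is an $R$-module which is a generator and gives a noncommutative crepant resolution (NCCR) of $R$. Then $R$ is normal.
   Context: For a finitely generated $R$-module $M$, $\operatorname{add} M$ is the category of direct summands of finite direct sums of copies of $M$; $M$ is a generator if $R \in \operatorname{add} M$. $A$ is a non-singular $R$-order if $A$ is a maximal Cohen--Macaulay $R$-module and $\operatorname{gldim} A_{\mathfrak p} = \dim R_{\mathfrak p}$ for all $\mathfrak p \in \operatorname{Spec} R$. A finitely generated torsion-free $R$-module $M$ with $\operatorname{supp} M = \operatorname{supp} R$ gives a NCCR of $R$ if $A=\operatorname{End}_R(M)$ is a non-singular $R$-order. A noetherian ring is normal if all its localizations at prime ideals are integrally closed domains. *)

(* Defs.v *)
From HB Require Import structures.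
From mathcomp Require Import all_boot all_order all_algebra.
From mathcomp Require Import generic_quotient ring.
From mathcomp Require Import all_classical constructive_ereal.

Set Implicit Arguments.
Unset Strict Implicit.
Unset Printing Implicit Defensive.

Import GRing.Theory.
Local Open Scope ring_scope.
Local Open Scope quotient_scope.
Local Open Scope classical_set_scope.

Definition nat_inf (P : set nat) : \bar nat :=
  if pselect (exists n, `[< P n >]) is left exP then EFin (ex_minn exP)
  else +oo%E.

(* The supremum of the empty set is -oo; this only occurs for the Krull
   dimension of the zero ring and for the depth of modules with I M = M. *)
Definition nat_sup (P : set nat) : \bar nat :=
  if pselect (P !=set0)
  then nat_inf [set n | forall m, P m -> (m <= n)%N] else -oo%E.

(* An R-algebra is a ring with a central ring morphism from R. The library's
   [algType] is not used because it only covers nonzero algebras, whereas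
   endomorphism rings and localizations may be zero. *)
HB.mixin Record PzRing_isPzAlgebra (R : comPzRingType) A
    of GRing.PzRing A := {
  alg_str : {rmorphism R -> A};
  alg_strC : forall (a : R) (x : A), alg_str a * x = x * alg_str a
}.

#[short(type="pzAlgType")]
HB.structure Definition PzAlgebra (R : comPzRingType) :=
  {A of GRing.PzRing A & PzRing_isPzAlgebra R A}.

Section AlgebraAsModule.
Variables (R : comPzRingType) (A : pzAlgType R).

Definition algmod : Type := A.

HB.instance Definition _ := GRing.Zmodule.on algmod.

Definition algmod_scale (a : R) (x : algmod) : algmod :=
  alg_str a * (x : A).

Fact algmod_scaleA a b x :
  algmod_scale a (algmod_scale b x) = algmod_scale (a * b) x.
Proof. by rewrite /algmod_scale rmorphM mulrA. Qed.
Fact algmod_scale1 : left_id 1 algmod_scale.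
Proof. by move=> x; rewrite /algmod_scale rmorph1 mul1r. Qed.
Fact algmod_scaleDr : right_distributive algmod_scale +%R.
Proof. by move=> a x y; rewrite /algmod_scale mulrDr. Qed.
Fact algmod_scaleDl x : {morph algmod_scale^~ x : a b / a + b}.
Proof. by move=> a b; rewrite /algmod_scale rmorphD mulrDl. Qed.

HB.instance Definition _ := GRing.Zmodule_isLmodule.Build R algmod
  algmod_scaleA algmod_scale1 algmod_scaleDr algmod_scaleDl.

Lemma algmodZE (a : R) (x : algmod) : a *: x = alg_str a * (x : A) :> A.
Proof. by []. Qed.

End AlgebraAsModule.
Arguments algmod {R} A.

Section RegularAlgebra.
Variable R : comPzRingType.
Definition regular_str : R -> R^o := idfun.
Fact regular_str_zmod : zmod_morphism regular_str. Proof. by []. Qed.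
Fact regular_str_monoid : monoid_morphism regular_str. Proof. by []. Qed.
HB.instance Definition _ :=
  GRing.isZmodMorphism.Build R R^o regular_str regular_str_zmod.
HB.instance Definition _ :=
  GRing.isMonoidMorphism.Build R R^o regular_str regular_str_monoid.
Fact regular_strC (a : R) (x : R^o) : regular_str a * x = x * regular_str a.
Proof. exact: mulrC. Qed.
HB.instance Definition _ :=
  PzRing_isPzAlgebra.Build R R^o regular_strC.
End RegularAlgebra.

Section EndomorphismAlgebra.
Variables (R : comPzRingType) (M : lmodType R).

(* Products in [endo] are compositions: (f * g) x = f (g x). *)
Definition endo : Type := {linear M -> M}.

HB.instance Definition _ := gen_eqMixin endo.
HB.instance Definition _ := gen_choiceMixin endo.

Definition endo_fun (f : endo) : M -> M := f : {linear M -> M}.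

Lemma endoP (f g : endo) : endo_fun f =1 endo_fun g -> f = g.
Proof.
case: f => f [[f1] [f2]]; case: g => g [[g1] [g2]] /= /funext.
rewrite /endo_fun /= => fg; case: g / fg g1 g2 => g1 g2.
by rewrite (Prop_irrelevance f1 g1) (Prop_irrelevance f2 g2).
Qed.

Definition endo0 : endo := \0.
Definition endo1 : endo := idfun.
Definition endo_opp (f : endo) : endo := \- (f : {linear M -> M}).
Definition endo_add (f g : endo) : endo :=
  (f : {linear M -> M}) \+ (g : {linear M -> M}).
Definition endo_mul (f g : endo) : endo :=
  (f : {linear M -> M}) \o (g : {linear M -> M}).
Definition endo_str (a : R) : endo := a \*: (idfun : {linear M -> M}).

Fact endo_addA : associative endo_add.
Proof. by move=> f g h; apply: endoP => x; apply: addrA. Qed.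
Fact endo_addC : commutative endo_add.
Proof. by move=> f g; apply: endoP => x; apply: addrC. Qed.
Fact endo_add0 : left_id endo0 endo_add.
Proof. by move=> f; apply: endoP => x; apply: add0r. Qed.
Fact endo_addN : left_inverse endo0 endo_opp endo_add.
Proof. by move=> f; apply: endoP => x; apply: addNr. Qed.
HB.instance Definition _ :=
  GRing.isZmodule.Build endo endo_addA endo_addC endo_add0 endo_addN.

Fact endo_mulA : associative endo_mul.
Proof. by move=> f g h; apply: endoP. Qed.
Fact endo_mul1 : left_id endo1 endo_mul.
Proof. by move=> f; apply: endoP. Qed.
Fact endo_mulr1 : right_id endo1 endo_mul.
Proof. by move=> f; apply: endoP. Qed.
Fact endo_mulDl : left_distributive endo_mul +%R.
Proof. by move=> f g h; apply: endoP. Qed.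
Fact endo_mulDr : right_distributive endo_mul +%R.
Proof. by move=> f g h; apply: endoP => x; apply: linearD. Qed.
HB.instance Definition _ := GRing.Zmodule_isPzRing.Build endo
  endo_mulA endo_mul1 endo_mulr1 endo_mulDl endo_mulDr.

Fact endo_str_zmod : zmod_morphism endo_str.
Proof. by move=> a b; apply: endoP => x; apply: scalerBl. Qed.
Fact endo_str_monoid : monoid_morphism endo_str.
Proof.
split=> [|a b]; apply: endoP => x; first exact: scale1r.
by rewrite [RHS]scalerA.
Qed.
HB.instance Definition _ :=
  GRing.isZmodMorphism.Build R endo endo_str endo_str_zmod.
HB.instance Definition _ :=
  GRing.isMonoidMorphism.Build R endo endo_str endo_str_monoid.
Fact endo_strC (a : R) (f : endo) : endo_str a * f = f * endo_str a.
Proof. by apply: endoP => x; rewrite /endo_fun /= linearZ. Qed.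
HB.instance Definition _ := PzRing_isPzAlgebra.Build R endo endo_strC.

End EndomorphismAlgebra.

Record mult_set (R : comPzRingType) := MultSet {
  mult_set_val :> set R;
  mult_set1 : 1 \in mult_set_val;
  mult_setM : forall s t,
    s \in mult_set_val -> t \in mult_set_val -> s * t \in mult_set_val
}.

Section LocalizationModule.
Variables (R : comPzRingType) (S : mult_set R) (M : lmodType R).

Definition denom1 : S := exist _ 1 (mult_set1 S).
Definition denomM (s t : S) : S :=
  exist _ (sval s * sval t) (mult_setM (valP s) (valP t)).

(* m / s = n / t iff u (t m - s n) = 0 for some u in S. *)
Definition loc_equiv (x y : M * S) : bool :=
  `[< exists u : S, sval u *: (sval y.2 *: x.1) = sval u *: (sval x.2 *: y.1) >].

Fact loc_equiv_refl : reflexive loc_equiv.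
Proof. by move=> x; apply/asboolP; exists denom1. Qed.
Fact loc_equiv_sym : symmetric loc_equiv.
Proof. by move=> x y; apply/asboolP/asboolP => -[u e]; exists u. Qed.
Fact loc_equiv_trans : transitive loc_equiv.
Proof.
move=> [n t] [m s] [k r] /asboolP[u /= eu] /asboolP[v /= ev].
apply/asboolP; exists (denomM (denomM u v) t) => /=; rewrite !scalerA.
rewrite (_ : _ * _ * _ * _ = (sval v * sval r) * (sval u * sval t)); last by ring.
rewrite -scalerA -[(_ * sval t) *: m]scalerA eu !scalerA.
rewrite (_ : _ * _ * _ = (sval u * sval s) * (sval v * sval r)); last by ring.
rewrite -scalerA -[(_ * sval r) *: n]scalerA ev !scalerA.
by congr (_ *: _); ring.
Qed.

Canonical loc_equivRel :=
  EquivRel loc_equiv loc_equiv_refl loc_equiv_sym loc_equiv_trans.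

Definition loc : Type := {eq_quot loc_equiv}.
HB.instance Definition _ := Choice.on loc.
HB.instance Definition _ := EqQuotient.on loc.

Definition frac (m : M) (s : S) : loc := \pi_loc (m, s).

Lemma frac_eq m s n t :
  frac m s = frac n t <->
  exists u : S, sval u *: (sval t *: m) = sval u *: (sval s *: n).
Proof.
split=> [/eqP|[u e]]; first by rewrite eqmodE => /asboolP.
by apply/eqP; rewrite eqmodE; apply/asboolP; exists u.
Qed.

Lemma fracE (x : loc) : frac (repr x).1 (repr x).2 = x.
Proof. by rewrite /frac -surjective_pairing reprK. Qed.

Variant frac_spec : loc -> Type := FracSpec m s : frac_spec (frac m s).
Lemma fracP x : frac_spec x.
Proof. by rewrite -(fracE x); split. Qed.

Definition loc_zero : loc := frac 0 denom1.
Definition loc_opp (x : loc) : loc := frac (- (repr x).1) (repr x).2.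
Definition loc_add (x y : loc) : loc :=
  let: (m, s) := repr x in let: (n, t) := repr y in
  frac (sval t *: m + sval s *: n) (denomM s t).

Lemma repr_frac m s : exists u : S,
  sval u *: (sval s *: (repr (frac m s)).1) =
  sval u *: (sval (repr (frac m s)).2 *: m).
Proof. by have := fracE (frac m s) => /frac_eq. Qed.

Lemma loc_oppE m s : loc_opp (frac m s) = frac (- m) s.
Proof.
rewrite /loc_opp; have [u e] := repr_frac m s.
by apply/frac_eq; exists u; rewrite !scalerN e.
Qed.

Lemma loc_addE m s n t : loc_add (frac m s) (frac n t) =
  frac (sval t *: m + sval s *: n) (denomM s t).
Proof.
have [u] := repr_frac m s; have [v] := repr_frac n t; rewrite /loc_add.
case: (repr _) => n' t' /= ev; case: (repr _) => m' s' /= eu.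
apply/frac_eq; exists (denomM u v) => /=.
rewrite !scalerDr !scalerA; congr (_ + _).
  rewrite (_ : _ * _ * _ * _ = (sval v * sval t * sval t') * (sval u * sval s));
    last by ring.
  rewrite -scalerA -[(_ * sval s) *: m']scalerA eu !scalerA.
  by congr (_ *: _); ring.
rewrite (_ : _ * _ * _ * _ = (sval u * sval s * sval s') * (sval v * sval t));
  last by ring.
rewrite -scalerA -[(_ * sval t) *: n']scalerA ev !scalerA.
by congr (_ *: _); ring.
Qed.

Lemma frac_congr m s n t :
  sval t *: m = sval s *: n -> frac m s = frac n t.
Proof. by move=> e; apply/frac_eq; exists denom1; rewrite e. Qed.

Fact loc_addA : associative loc_add.
Proof.
move=> x y z; case: (fracP x) => m s; case: (fracP y) => n t.
case: (fracP z) => k r; rewrite !loc_addE; apply: frac_congr => /=.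
rewrite !scalerDr !scalerA addrA.
by congr (_ *: _ + _ *: _ + _ *: _); ring.
Qed.
Fact loc_addC : commutative loc_add.
Proof.
move=> x y; case: (fracP x) => m s; case: (fracP y) => n t.
by rewrite !loc_addE; apply: frac_congr => /=; rewrite addrC [sval s * _]mulrC.
Qed.
Fact loc_add0 : left_id loc_zero loc_add.
Proof.
move=> x; case: (fracP x) => m s; rewrite loc_addE; apply: frac_congr => /=.
by rewrite scaler0 add0r scalerA mulrC.
Qed.
Fact loc_addN : left_inverse loc_zero loc_opp loc_add.
Proof.
move=> x; case: (fracP x) => m s; rewrite loc_oppE loc_addE.
by apply: frac_congr => /=; rewrite scalerN addNr !scaler0.
Qed.
HB.instance Definition _ :=
  GRing.isZmodule.Build loc loc_addA loc_addC loc_add0 loc_addN.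

End LocalizationModule.

Section LocalizationAlgebra.
Variables (R : comPzRingType) (S : mult_set R) (A : pzAlgType R).

Definition loc_alg : Type := loc S (algmod A).
HB.instance Definition _ := GRing.Zmodule.on loc_alg.

Definition loc_one : loc_alg := frac ((1 : A) : algmod A) (denom1 S).
Definition loc_mul (x y : loc_alg) : loc_alg :=
  let: (a, s) := repr x in let: (b, t) := repr y in
  frac ((a : A) * (b : A) : algmod A) (denomM s t).

Lemma algmodZAl (a : R) (x y : A) :
  a *: (x * y : algmod A) = (a *: (x : algmod A) : A) * y.
Proof. by rewrite !algmodZE mulrA. Qed.
Lemma algmodZAr (a : R) (x y : A) :
  a *: (x * y : algmod A) = x * (a *: (y : algmod A) : A).
Proof. by rewrite !algmodZE !mulrA alg_strC. Qed.

Lemma algmodZM (a b : R) (x y : A) : (a * b) *: (x * y : algmod A) =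
  (a *: (x : algmod A) : A) * (b *: (y : algmod A) : A).
Proof. by rewrite -scalerA algmodZAr algmodZAl. Qed.

Lemma loc_mulE (a b : A) (s t : S) :
  loc_mul (frac (a : algmod A) s) (frac (b : algmod A) t) =
  frac (a * b : algmod A) (denomM s t).
Proof.
have [u] := @repr_frac _ S (algmod A) a s.
have [v] := @repr_frac _ S (algmod A) b t; rewrite /loc_mul.
case: (repr _) => b' t' /= ev; case: (repr _) => a' s' /= eu.
apply/frac_eq; exists (denomM u v) => /=.
rewrite !scalerA (_ : _ * _ * _ = (sval u * sval s) * (sval v * sval t));
  last by ring.
rewrite algmodZM -!scalerA ev eu !scalerA -algmodZM.
by congr (_ *: _); ring.
Qed.

Fact loc_mulA : associative loc_mul.
Proof.
move=> x y z; case: (fracP x) => a s; case: (fracP y) => b t.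
case: (fracP z) => c r; rewrite !loc_mulE; apply: frac_congr => /=.
by rewrite !mulrA.
Qed.
Fact loc_mul1 : left_id loc_one loc_mul.
Proof.
move=> x; case: (fracP x) => a s; rewrite loc_mulE; apply: frac_congr => /=.
by rewrite !mul1r.
Qed.
Fact loc_mulr1 : right_id loc_one loc_mul.
Proof.
move=> x; case: (fracP x) => a s; rewrite loc_mulE; apply: frac_congr => /=.
by rewrite !mulr1.
Qed.
Fact loc_mulDl : left_distributive loc_mul +%R.
Proof.
move=> x y z; case: (fracP x) => a s; case: (fracP y) => b t.
case: (fracP z) => c r; rewrite [_ + _]loc_addE !loc_mulE [RHS]loc_addE.
apply: frac_congr => /=.
rewrite [X in _ *: X]mulrDl -!algmodZAl !scalerDr !scalerA.
by congr (_ *: _ + _ *: _); ring.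
Qed.
Fact loc_mulDr : right_distributive loc_mul +%R.
Proof.
move=> x y z; case: (fracP x) => a s; case: (fracP y) => b t.
case: (fracP z) => c r; rewrite [_ + _]loc_addE !loc_mulE [RHS]loc_addE.
apply: frac_congr => /=.
rewrite [X in _ *: X]mulrDr -!algmodZAr !scalerDr !scalerA.
by congr (_ *: _ + _ *: _); ring.
Qed.
HB.instance Definition _ := GRing.Zmodule_isPzRing.Build loc_alg
  loc_mulA loc_mul1 loc_mulr1 loc_mulDl loc_mulDr.

End LocalizationAlgebra.

Section LocalizationRing.
Variables (R : comPzRingType) (S : mult_set R).

Definition loc_ring : Type := loc_alg S R^o.
HB.instance Definition _ := GRing.PzRing.on loc_ring.

Fact loc_ring_mulC : @commutative loc_ring loc_ring *%R.
Proof.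
move=> x y; case: (fracP x) => a s; case: (fracP y) => b t.
rewrite [LHS]loc_mulE [RHS]loc_mulE; apply: frac_congr => /=.
by rewrite [b * a]mulrC [sval s * _]mulrC.
Qed.
HB.instance Definition _ :=
  GRing.PzRing_hasCommutativeMul.Build loc_ring loc_ring_mulC.

Definition rfrac (a : R) (s : S) : loc_ring := frac (a : algmod R^o) s.

Variable M : lmodType R.

Definition loc_scale (x : loc_ring) (y : loc S M) : loc S M :=
  let: (a, s) := repr x in let: (m, t) := repr y in
  frac ((a : R) *: m) (denomM s t).

Lemma loc_scaleE (a : R) (s : S) (m : M) (t : S) :
  loc_scale (rfrac a s) (frac m t) = frac (a *: m) (denomM s t).
Proof.
have [u] := @repr_frac _ S (algmod R^o) a s.
have [v] := repr_frac m t; rewrite /loc_scale /rfrac.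
case: (repr _) => m' t' /= ev; case: (repr _) => a' s' /= eu.
apply/frac_eq; exists (denomM u v) => /=; rewrite !scalerA.
have {}eu : sval u * (sval s * a') = sval u * (sval s' * a) := eu.
rewrite (_ : _ * a' = (sval u * (sval s * a')) * (sval v * sval t)); last by ring.
rewrite eu -scalerA -[(_ * sval t) *: m']scalerA ev !scalerA.
by congr (_ *: _); ring.
Qed.

Fact loc_scaleA x y v : loc_scale x (loc_scale y v) = loc_scale (x * y) v.
Proof.
case: (fracP x) => a s; case: (fracP y) => b t; case: (fracP v) => m r.
rewrite [_ * _]loc_mulE !loc_scaleE; apply: frac_congr => /=.
by rewrite !scalerA; congr (_ *: _); rewrite !mulrA.
Qed.
Fact loc_scale1 : left_id 1 loc_scale.
Proof.
move=> v; case: (fracP v) => m r; rewrite [LHS]loc_scaleE.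
by apply: frac_congr => /=; rewrite scale1r mul1r.
Qed.
Fact loc_scaleDr : right_distributive loc_scale +%R.
Proof.
move=> x v w; case: (fracP x) => a s; case: (fracP v) => m t.
case: (fracP w) => n r; rewrite [_ + _]loc_addE !loc_scaleE [RHS]loc_addE.
apply: frac_congr => /=; rewrite !scalerDr !scalerA.
by congr (_ *: _ + _ *: _); ring.
Qed.
Fact loc_scaleDl v : {morph loc_scale^~ v : x y / x + y}.
Proof.
move=> x y; case: (fracP x) => a s; case: (fracP y) => b t.
case: (fracP v) => m r; rewrite [x in loc_scale x _]loc_addE !loc_scaleE.
rewrite [RHS]loc_addE; apply: frac_congr => /=.
have scE c (d : algmod R^o) : c *: d = c * d :> R by [].
rewrite !scE scalerDl !scalerDr !scalerA.
by congr (_ *: _ + _ *: _); ring.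
Qed.
HB.instance Definition _ := GRing.Zmodule_isLmodule.Build loc_ring (loc S M)
  loc_scaleA loc_scale1 loc_scaleDr loc_scaleDl.

End LocalizationRing.

Definition is_ideal (R : comPzRingType) (I : set R) : Prop :=
  [/\ I 0, forall x y, I x -> I y -> I (x + y) & forall a x, I x -> I (a * x)].

Record spec (R : comPzRingType) := Prime {
  prime_val :> set R;
  prime_ideal : is_ideal prime_val;
  prime_proper : ~ prime_val 1;
  primeP : forall x y, prime_val (x * y) -> prime_val x \/ prime_val y
}.

Definition noetherian (R : comPzRingType) : Prop :=
  forall I : set R, is_ideal I -> exists (n : nat) (g : 'I_n -> R),
    I = [set x | exists c : 'I_n -> R, x = \sum_i c i * g i].

Definition krull_dim (R : comPzRingType) : \bar nat :=
  nat_sup [set n | exists p : nat -> spec R,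
    forall i, (i < n)%N -> p i `<` p i.+1].

Section LocalizationAtPrime.
Variables (R : comPzRingType) (p : spec R).

Fact prime_compl1 : 1 \in ~` p.
Proof. by rewrite inE; apply: prime_proper. Qed.
Fact prime_complM s t : s \in ~` p -> t \in ~` p -> s * t \in ~` p.
Proof. by rewrite !inE => ps pt /primeP[]. Qed.
Definition prime_compl : mult_set R := MultSet prime_compl1 prime_complM.

Definition ring_at : comPzRingType := loc_ring prime_compl.
Definition module_at (M : lmodType R) : lmodType ring_at := loc prime_compl M.
Definition algebra_at (A : pzAlgType R) : pzRingType := loc_alg prime_compl A.

Definition maximal_at : set ring_at :=
  [set x | exists a s, (p : set R) a /\ x = rfrac (S := prime_compl) a s].

End LocalizationAtPrime.

Definition integrally_closed (D : idomainType) : Prop :=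
  forall x : {fraction D},
    integralOver (@tofrac D) x -> exists a : D, x = tofrac a.

Definition integrally_closed_domain (R : comPzRingType) : Prop :=
  exists (D : idomainType) (f : {rmorphism R -> D}),
    bijective f /\ integrally_closed D.

Definition normal_ring (R : comPzRingType) : Prop :=
  forall p : spec R, integrally_closed_domain (ring_at p).

Section Modules.
Variables (R : comPzRingType) (M : lmodType R).

Definition finitely_generated : Prop :=
  exists (n : nat) (g : 'I_n -> M),
    forall x, exists c : 'I_n -> R, x = \sum_i c i *: g i.

Definition torsion_free : Prop :=
  forall r : R, (forall s, r * s = 0 -> s = 0) ->
  forall x : M, r *: x = 0 -> x = 0.

Definition supp : set (spec R) :=
  [set p | exists x : module_at p M, x <> 0].

Definition in_add (N : lmodType R) : Prop :=
  exists (n : nat) (K : lmodType R)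
         (f : {linear (N * K)%type -> {ffun 'I_n -> M}}), bijective f.

Definition generator : Prop := in_add R^o.

(* (x_0, ..., x_{n-1}) M *)
Definition seq_submod (x : nat -> R) (n : nat) : set M :=
  [set v | exists w : 'I_n -> M, v = \sum_(i < n) x i *: w i].

Definition regular_seq (x : nat -> R) (n : nat) : Prop :=
  (forall k v, (k < n)%N ->
     seq_submod x k (x k *: v) -> seq_submod x k v) /\
  seq_submod x n <> setT.

Definition depth (I : set R) : \bar nat :=
  nat_sup [set n | exists x : nat -> R,
    (forall k, (k < n)%N -> I (x k)) /\ regular_seq x n].

End Modules.

(* The zero module has infinite depth by convention, so that only the primes in
   the support give a condition. *)
Definition maximal_cohen_macaulay (R : comPzRingType) (M : lmodType R) :
    Prop :=
  finitely_generated M /\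
  forall p : spec R, supp M p ->
    depth (module_at p M) (maximal_at (p := p)) = krull_dim (ring_at p).

Definition projective (A : pzRingType) (P : lmodType A) : Prop :=
  forall (M N : lmodType A) (g : {linear M -> N}) (f : {linear P -> N}),
    (forall y, exists x, g x = y) ->
    exists h : {linear P -> M}, forall x, g (h x) = f x.

Definition has_proj_resolution_le (A : pzRingType) (M : lmodType A) (n : nat) :
    Prop :=
  exists (P : nat -> lmodType A)
         (d : forall i, {linear P i.+1 -> P i}) (e : {linear P 0%N -> M}),
    [/\ forall i, projective (P i),
        forall i, (n < i)%N -> forall x : P i, x = 0,
        forall y, exists x, e x = y,
        forall x, e x = 0 <-> exists y, d 0%N y = x
      & forall i x, d i x = 0 <-> exists y, d i.+1 y = x].

(* Left modules are used; for the module-finite algebras over a noetherian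
   ring considered here, the left and right global dimensions agree. *)
Definition gldim (A : pzRingType) : \bar nat :=
  nat_inf [set n | forall M : lmodType A, has_proj_resolution_le M n].

Definition nonsingular_order (R : comPzRingType) (A : pzAlgType R) : Prop :=
  maximal_cohen_macaulay (algmod A) /\
  forall p : spec R, gldim (algebra_at p A) = krull_dim (ring_at p).

Definition gives_NCCR (R : comPzRingType) (M : lmodType R) : Prop :=
  [/\ finitely_generated M, torsion_free M, supp M = supp R^o
    & nonsingular_order (endo M)].

(* Main.v *)
Require Import Defs.
From HB Require Import structures.
From mathcomp Require Import all_boot all_algebra.
From mathcomp Require Import generic_quotient ring.
From mathcomp Require Import all_classical constructive_ereal.
Import Defs.

(** A generator [M] makes [R] a direct summand of [A = End M] as an [R]-module:
    there is an [R]-linear [tau : A -> R] with [tau 1 = 1].  Fix a prime [p].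

    If [dim R_p >= 2], then [A_p], and hence its summand [R_p], has a regular
    sequence of length 2.  If [dim R_p <= 1], then [gldim A_p <= 1], so the left
    ideal [p A_p] is projective; applying [tau] to a dual basis of it gives a
    dual basis of [p R_p], which is therefore zero or principal generated by a
    regular element.

    So every prime satisfies a form of Serre's conditions R1 and S2.  The usual
    argument then shows that [R_p] is reduced, a domain and integrally closed,
    by looking at an associated prime [q] of [R/0], of [R/(ann a + ann ann a)]
    and of [R/(b)] respectively. *)

Set Implicit Arguments.
Unset Strict Implicit.
Unset Printing Implicit Defensive.

Import GRing.Theory.
Local Open Scope ring_scope.
Local Open Scope quotient_scope.
Local Open Scope classical_set_scope.

(** * Quotient modules and projective lifting *)

Section QuotientModule.
Variables (A : pzRingType) (V : lmodType A) (S : set V).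
Hypothesis S_submod : submod_closed (fun v => `[< S v >]).

Lemma submod0 : S 0.
Proof. by case: S_submod => /asboolP. Qed.
Lemma submodZD a u v : S u -> S v -> S (a *: u + v).
Proof.
by move=> Su Sv; case: S_submod => _ /(_ a u v) h; apply/asboolP/h; apply/asboolP.
Qed.
Lemma submodD u v : S u -> S v -> S (u + v).
Proof. by move=> Su Sv; rewrite -[u]scale1r; apply: submodZD. Qed.
Lemma submodZ a u : S u -> S (a *: u).
Proof. by move=> Su; rewrite -[_ *: _]addr0; apply: submodZD submod0. Qed.

Definition quo_equiv (u v : V) : bool := `[< S (u - v) >].
Fact quo_equiv_refl : reflexive quo_equiv.
Proof. by move=> u; apply/asboolP; rewrite subrr; apply: submod0. Qed.
Fact quo_equiv_sym : symmetric quo_equiv.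
Proof.
by move=> u v; apply/asboolP/asboolP => /(submodZ (- 1)); rewrite scaleN1r opprB.
Qed.
Fact quo_equiv_trans : transitive quo_equiv.
Proof.
move=> v u w /asboolP uv /asboolP vw; apply/asboolP.
by rewrite -(subrKA v); apply: submodD.
Qed.
Canonical quo_equivRel :=
  EquivRel quo_equiv quo_equiv_refl quo_equiv_sym quo_equiv_trans.

Definition quo : Type := {eq_quot quo_equiv}.
HB.instance Definition _ := Choice.on quo.
HB.instance Definition _ := EqQuotient.on quo.

Definition quo_class (v : V) : quo := \pi_quo v.

Lemma quo_classE u v : quo_class u = quo_class v <-> S (u - v).
Proof.
split=> [/eqP|uv]; first by rewrite eqmodE => /asboolP.
by apply/eqP; rewrite eqmodE; apply/asboolP.
Qed.

Lemma quo_class_repr (x : quo) : quo_class (repr x) = x.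
Proof. exact: reprK. Qed.

Definition quo_opp (x : quo) : quo := quo_class (- repr x).
Definition quo_add (x y : quo) : quo := quo_class (repr x + repr y).
Definition quo_scale a (x : quo) : quo := quo_class (a *: repr x).

Lemma quo_oppE u : quo_opp (quo_class u) = quo_class (- u).
Proof.
apply/quo_classE; rewrite opprK addrC; apply/quo_classE.
by rewrite quo_class_repr.
Qed.
Lemma quo_addE u v : quo_add (quo_class u) (quo_class v) = quo_class (u + v).
Proof.
apply/quo_classE; rewrite opprD addrACA.
by apply: submodD; apply/quo_classE; rewrite quo_class_repr.
Qed.
Lemma quo_scaleE a u : quo_scale a (quo_class u) = quo_class (a *: u).
Proof.
apply/quo_classE; rewrite -scalerBr; apply: submodZ; apply/quo_classE.
by rewrite quo_class_repr.
Qed.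

Variant quo_spec : quo -> Type := QuoSpec v : quo_spec (quo_class v).
Lemma quoP x : quo_spec x.
Proof. by rewrite -[x]quo_class_repr; split. Qed.

Fact quo_addA : associative quo_add.
Proof.
move=> x y z; case: (quoP x) => u; case: (quoP y) => v; case: (quoP z) => w.
by rewrite (quo_addE v w) (quo_addE u v) (quo_addE u) (quo_addE (u + v)) addrA.
Qed.
Fact quo_addC : commutative quo_add.
Proof. by move=> x y; rewrite /quo_add addrC. Qed.
Fact quo_add0 : left_id (quo_class 0) quo_add.
Proof. by move=> x; case: (quoP x) => u; rewrite quo_addE add0r. Qed.
Fact quo_addN : left_inverse (quo_class 0) quo_opp quo_add.
Proof. by move=> x; case: (quoP x) => u; rewrite quo_oppE quo_addE addNr. Qed.
HB.instance Definition _ :=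
  GRing.isZmodule.Build quo quo_addA quo_addC quo_add0 quo_addN.

Fact quo_scaleA a b x : quo_scale a (quo_scale b x) = quo_scale (a * b) x.
Proof.
by case: (quoP x) => u; rewrite (quo_scaleE b u) !quo_scaleE scalerA.
Qed.
Fact quo_scale1 : left_id 1 quo_scale.
Proof. by move=> x; case: (quoP x) => u; rewrite quo_scaleE scale1r. Qed.
Fact quo_scaleDr : right_distributive quo_scale +%R.
Proof.
move=> a x y; case: (quoP x) => u; case: (quoP y) => v.
by rewrite [_ + quo_class v]quo_addE !quo_scaleE [RHS]quo_addE scalerDr.
Qed.
Fact quo_scaleDl x : {morph quo_scale^~ x : a b / a + b}.
Proof.
move=> a b; case: (quoP x) => u.
by rewrite !quo_scaleE [RHS]quo_addE scalerDl.
Qed.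
HB.instance Definition _ := GRing.Zmodule_isLmodule.Build A quo
  quo_scaleA quo_scale1 quo_scaleDr quo_scaleDl.

Fact quo_class_linear : linear quo_class.
Proof. by move=> a u v; rewrite -quo_addE -quo_scaleE. Qed.
HB.instance Definition _ :=
  GRing.isLinear.Build A V quo *:%R quo_class quo_class_linear.

Lemma quo_class_eq0 v : quo_class v = 0 <-> S v.
Proof. by rewrite -[X in _ <-> S X]subr0 -quo_classE. Qed.

End QuotientModule.

Section Lifting.
Variables (A : pzRingType) (P V W : lmodType A).

(** Projectivity lifts along surjections only, while [pi] merely covers the image of [f]. The
    quotient of [V] by the kernel of [pi] replaces the target: choosing preimages turns [f] into a
    linear map to it, and the class map is onto. *)
Lemma projective_lift (pi : {linear V -> W}) (f : {linear P -> W}) :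
  projective P -> (forall p, exists v, pi v = f p) ->
  exists h : {linear P -> V}, forall p, pi (h p) = f p.
Proof.
move=> projP imf; pose S : set V := [set v | pi v = 0].
have S_submod : submod_closed (fun v => `[< S v >]).
  split=> [|a u v /asboolP Su /asboolP Sv]; apply/asboolP; rewrite /S /= ?linear0 //.
  by rewrite linearP Su Sv scaler0 addr0.
pose q := quo_class S_submod.
have qE u v : pi u = pi v -> q u = q v.
  by move=> e; apply/quo_classE; rewrite /S /= linearB /= e subrr.
pose v p := sval (cid (imf p)).
have vE p : pi (v p) = f p by rewrite /v; case: cid.
have fq_linear : linear (fun p => q (v p)).
  move=> a x y; rewrite -linearP; apply: qE.
  by rewrite linearP !vE linearP.
pose fqM := GRing.isLinear.Build _ _ _ _ (fun p => q (v p)) fq_linear.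
pose fq : {linear P -> quo S_submod} := HB.pack (fun p => q (v p)) fqM.
have qsurj (y : quo S_submod) : exists x, q x = y.
  by exists (repr y); apply: quo_class_repr.
have [h hE] := projP _ _ (q : {linear _ -> _}) fq qsurj.
exists h => p; rewrite -[RHS]vE; apply/eqP; rewrite -subr_eq0 -linearB; apply/eqP.
by have /quo_classE := hE p.
Qed.

End Lifting.

(** * Dual bases of extended ideals *)

Section DualBasis.
Variables (R : comPzRingType) (A : pzRingType) (iota : {rmorphism R -> A}).
Hypothesis iotaC : forall r a, iota r * a = a * iota r.
Variables (k : nat) (x : 'I_k -> R).

Definition ideal_comb (v : {ffun 'I_k -> A^o}) : A^o := \sum_j iota (x j) * v j.

Fact ideal_comb_linear : linear ideal_comb.
Proof.
move=> a u v; rewrite /ideal_comb scaler_sumr -big_split; apply: eq_bigr => j _ /=.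
rewrite !ffunE mulrDr; congr (_ + _).
by rewrite [LHS]mulrA iotaC -[LHS]mulrA.
Qed.
HB.instance Definition _ :=
  GRing.isLinear.Build A _ A^o *:%R ideal_comb ideal_comb_linear.

Definition ideal_ext : set A^o := range ideal_comb.

Fact ideal_ext_submod : submod_closed (fun v => `[< ideal_ext v >]).
Proof.
split=> [|a u v /asboolP[u' _ <-] /asboolP[v' _ <-]]; apply/asboolP.
  by exists 0; rewrite ?linear0.
by exists (a *: u' + v'); rewrite ?linearP.
Qed.

Lemma ideal_ext_gen i : ideal_ext (iota (x i)).
Proof.
exists [ffun j => (j == i)%:R] => //; rewrite /ideal_comb (bigD1 i) //= ffunE eqxx.
rewrite mulr1 big1 ?addr0 // => j /negPf ji; by rewrite ffunE ji mulr0.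
Qed.

(* A/IA has projective dimension at most 1, so IA is projective by Schanuel's
   lemma; [sigma i j] is the j-th coordinate of [x i] in a dual basis. *)
Lemma ideal_dual_basis :
  (forall N : lmodType A, has_proj_resolution_le N 1) ->
  exists sigma : 'I_k -> 'I_k -> A,
    (forall i, iota (x i) = \sum_j iota (x j) * sigma i j) /\
    (forall r : 'I_k -> R, \sum_i r i * x i = 0 ->
       forall j, \sum_i iota (r i) * sigma i j = 0).
Proof.
move=> /(_ (quo ideal_ext_submod))[P [d [e [projP P0 esurj exact0 exact1]]]].
pose g := quo_class ideal_ext_submod.
have gE a : a *: g 1 = g a.
  by rewrite /g -linearZ; congr quo_class; apply: mulr1.
(* The maps [l] and [a *: p0] in [a] compare the two covers [P 0] and [A] of the quotient; [v0]
   records that [l p0] is 1 only modulo the ideal. *)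
have [p0 ep0] := esurj (g 1).
have gsurj p : exists a, g a = e p.
  by exists (repr (e p)); apply: quo_class_repr.
have [l lE] := projective_lift (pi := g : {linear _ -> _}) (projP 0%N) gsurj.
have [v0 _ v0E] : ideal_ext (1 - l p0).
  by apply/(@quo_classE _ _ _ ideal_ext_submod); rewrite -[LHS]/(g 1) -ep0 -lE.
have /choice[w wE] : forall i, exists w, d 0%N w = iota (x i) *: p0.
  move=> i; apply/exact0; rewrite linearZ /= ep0 gE; apply/quo_class_eq0.
  exact: ideal_ext_gen.
(* The resolution has length 1, so [P 2] vanishes. Injectivity carries relations between the [x i]
   over to the [w i]. *)
have d_inj z : d 0%N z = 0 -> z = 0.
  by move=> /exact1[y <-]; rewrite (P0 2%N _ y) ?linear0.
have ld_ideal p : exists v, ideal_comb v = l (d 0%N p).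
  have /quo_class_eq0[v _ <-] : g (l (d 0%N p)) = 0.
    by apply: etrans (lE _) _; apply/exact0; exists p.
  by exists v.
have [h hE] := projective_lift (pi := ideal_comb : {linear _ -> _})
  (f := l \o d 0%N : {linear _ -> _}) (projP 1%N) ld_ideal.
(* In the sum over [j] the first term contributes [x i] times [l p0], the second [x i] times
   [1 - l p0]. *)
exists (fun i j => h (w i) j + iota (x i) * v0 j); split=> [i|r rx0 j].
  under eq_bigr do rewrite mulrDr mulrA -[iota _ * iota _]iotaC -mulrA.
  rewrite big_split -mulr_sumr /=.
  rewrite -[X in X + _]/(ideal_comb _) -[X in _ + _ * X]/(ideal_comb _) hE v0E /=.
  by rewrite wE linearZ /= mulrBr mulr1 addrC; apply/esym/subrK.
have w0 : \sum_i iota (r i) *: w i = 0.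
  apply: d_inj; rewrite linear_sum.
  under eq_bigr do rewrite linearZ /= wE scalerA -rmorphM.
  by rewrite -scaler_suml -rmorph_sum rx0 rmorph0 scale0r.
under eq_bigr do rewrite mulrDr mulrA -rmorphM.
rewrite big_split -mulr_suml -rmorph_sum rx0 rmorph0 mul0r [LHS]addr0 /=.
have := congr1 (fun p => h p j) w0; rewrite linear_sum linear0 sum_ffunE ffunE => h0.
by rewrite -[RHS]h0; apply: eq_bigr => i _; rewrite linearZ ffunE.
Qed.

End DualBasis.

(** * Serre's criterion for local rings *)

Section IdealsAndPrimes.
Variable R : comPzRingType.
Implicit Types (I : set R) (q : spec R).

Lemma ideal0 I : is_ideal I -> I 0.
Proof. by case. Qed.
Lemma idealD I a b : is_ideal I -> I a -> I b -> I (a + b).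
Proof. by case=> _ h _; apply: h. Qed.
Lemma idealMl I a b : is_ideal I -> I b -> I (a * b).
Proof. by case=> _ _; apply. Qed.
Lemma idealMr I a b : is_ideal I -> I a -> I (a * b).
Proof. by move=> idI Ia; rewrite mulrC; apply: idealMl. Qed.
Lemma idealB I a b : is_ideal I -> I a -> I b -> I (a - b).
Proof. by move=> idI Ia Ib; rewrite -mulN1r; apply: idealD => //; apply: idealMl. Qed.
Lemma ideal_sum I (T : Type) (r : seq T) (P : pred T) (F : T -> R) :
  is_ideal I -> (forall i, P i -> I (F i)) -> I (\sum_(i <- r | P i) F i).
Proof.
by move=> idI IF; apply: big_ind => // [|a b]; [apply: ideal0 | apply: idealD].
Qed.

Lemma prime_mulN q s t : ~ prime_val q s -> ~ prime_val q t -> ~ prime_val q (s * t).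
Proof. by move=> qs qt /primeP[]. Qed.

Lemma prime_prodN q (T : Type) (r : seq T) (P : pred T) (F : T -> R) :
  (forall i, P i -> ~ prime_val q (F i)) -> ~ prime_val q (\prod_(i <- r | P i) F i).
Proof.
by move=> qF; apply: (big_ind (fun a => ~ prime_val q a)) => // [|a b];
  [apply: prime_proper | apply: prime_mulN].
Qed.

Lemma prime_exp q w n : prime_val q (w ^+ n) -> prime_val q w.
Proof.
elim: n => [|n IHn]; first by rewrite expr0 => /prime_proper.
by rewrite exprS => /primeP[].
Qed.

(** Without a maximal member, choice builds a strictly ascending chain in [F]. Its union is an ideal
    whose finitely many generators already lie in one term. *)
Lemma noetherian_max (F : set (set R)) (I0 : set R) : noetherian R ->
  (forall I, F I -> is_ideal I) -> F I0 ->
  exists2 I, F I & forall J, F J -> I `<=` J -> J `<=` I.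
Proof.
move=> noethR idF FI0; apply: contrapT => nomax.
have /choice[f fP] (I : {I | F I}) :
    exists J : {J | F J}, sval I `<=` sval J /\ ~ (sval J `<=` sval I).
  case: I => I FI /=; apply: contrapT => noJ; apply: nomax; exists I => // J FJ IJ.
  by apply: contrapT => JI; apply: noJ; exists (exist _ J FJ).
pose u n := sval (iter n f (exist _ I0 FI0)).
have idu n : is_ideal (u n) by apply: idF; apply: (svalP (iter n f _)).
have u_sub m n : (m <= n)%N -> u m `<=` u n.
  elim: n => [|n IHn]; first by rewrite leqn0 => /eqP->.
  rewrite leq_eqVlt => /predU1P[->//|/IHn umn].
  exact: (subset_trans umn (fP _).1).
have idU : is_ideal (\bigcup_n u n).
  split=> [|a b [m _ am] [n _ bn]|a b [n _ bn]].
  - by exists 0%N => //; apply: ideal0 (idu _).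
  - by exists (maxn m n) => //; apply: idealD (idu _) _ _;
      [apply: u_sub am; rewrite leq_maxl | apply: u_sub bn; rewrite leq_maxr].
  - by exists n => //; apply: (idealMl _ (idu _)) bn.
have [k [g gU]] := noethR _ idU.
have /choice[e eP] i : exists n, u n (g i).
  have : (\bigcup_n u n) (g i); last by case=> n _ gi; exists n.
  rewrite gU; exists (fun j => (j == i)%:R); rewrite (bigD1 i) //= eqxx mul1r.
  by rewrite big1 ?addr0 // => j /negPf->; rewrite mul0r.
pose N := \max_i e i; have [_] := fP (iter N f (exist _ I0 FI0)); apply.
move=> a aN; have : (\bigcup_n u n) a by exists N.+1.
rewrite gU => -[c ->]; apply: ideal_sum (idu N) _ => i _.
by apply: (idealMl _ (idu N)); apply: u_sub (eP i); apply: leq_bigmax.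
Qed.

(** A maximal proper colon ideal [I : r t] is prime: if it contains [x y] but not [y], then
    [I : y r t] is still proper and contains it, so the two agree and [x] belongs to both. Relations
    satisfied by [t] pass to the multiple [r t]. *)
Lemma associated_prime I t : noetherian R -> is_ideal I -> ~ I t ->
  exists q r, forall s, prime_val q s <-> I (s * (r * t)).
Proof.
move=> noethR idI It.
pose colon r := [set s | I (s * (r * t))].
have id_colon r : is_ideal (colon r).
  split=> [|a b|a b]; rewrite /colon /= ?mul0r; first exact: ideal0.
    by rewrite mulrDl; apply: idealD.
  by rewrite -mulrA; apply: idealMl.
pose F := [set J | exists2 r, ~ I (r * t) & J = colon r].
have [||_ [r Irt ->] maxr] := noetherian_max (F := F) (I0 := colon 1) noethR.
- by move=> _ [r _ ->].
- by exists 1 => //; rewrite mul1r.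
have proper : ~ colon r 1 by rewrite /colon /= mul1r.
have primeC x y : colon r (x * y) -> colon r x \/ colon r y.
  move=> xy; have [|ny] := pselect (colon r y); [by right | left].
  apply: (maxr (colon (y * r))).
  - by exists (y * r); rewrite // -mulrA.
  - by move=> s Is; rewrite /colon /= -[y * r * t]mulrA mulrCA; apply: (idealMl _ idI).
  - by move: xy; rewrite /colon /= !mulrA.
by exists (Prime (id_colon r) proper primeC), r.
Qed.

End IdealsAndPrimes.

Section SerrePrimes.
Variables (R : comPzRingType) (q : set R).

(** Vanishing, and below divisibility, in the localization at [q], written with denominators so that
    the statements stay in [R]. *)
Definition local_zero (u : R) : Prop := exists2 s, ~ q s & s * u = 0.
Definition local_dvd (y u : R) : Prop :=
  exists2 s, ~ q s & exists w, s * u = y * w.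

(* Elementwise form of: R_q has depth at least 2, or is a field, or is local
   with maximal ideal generated by a regular element. *)
Variant serre_prime : Prop :=
| SerreDepth2 x y of q x & q y & (forall u, x * u = 0 -> local_zero u)
    & (forall u v, y * u = x * v -> local_dvd x u)
| SerreField of (forall u, q u -> local_zero u)
| SerreValuation y of q y & (forall u, y * u = 0 -> local_zero u)
    & (forall u, q u -> local_dvd y u).

End SerrePrimes.

Section SerreLocalRing.
Variable B : comPzRingType.
Hypothesis noethB : noetherian B.
Hypothesis localB : forall x y : B, x + y = 1 ->
  (exists z, z * x = 1) \/ (exists z, z * y = 1).
Hypothesis serreB : forall q : spec B, serre_prime q.

Lemma ideal_set0 : is_ideal [set (0 : B)].
Proof. by split=> // [a b -> ->|a b ->]; rewrite ?addr0 ?mulr0. Qed.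

(** A nonzero [c] has a multiple [r * c] with prime annihilator [q], so no element of [q] is regular
    at [q] and only the field case is left. There [c] lies in [q] and dies locally, which puts a
    denominator into [q]. *)
Lemma serre_reduced (c : B) : c * c = 0 -> c = 0.
Proof.
move=> cc; apply: contrapT => /(associated_prime noethB ideal_set0)[q [r qE]].
have ann s : s * (r * c) = 0 -> prime_val q s by move=> h; apply/qE.
have qc : prime_val q c by apply: ann; rewrite mulrCA cc mulr0.
have reg x : prime_val q x -> (forall u, x * u = 0 -> local_zero q u) -> False.
  by move=> /qE xrc /(_ _ xrc)[s qs /ann].
case: (serreB q) => [x y qx _ xreg _|qzero|y qy yreg _].
- exact: reg xreg.
- by have [s qs sc] := qzero _ qc; apply/qs/ann; rewrite mulrCA sc mulr0.
- exact: reg yreg.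
Qed.

Section ZeroDivisor.
Variable a : B.

Let J : set B := [set j | j * a = 0].
Let K : set B := [set k | forall j, J j -> j * k = 0].
Let I : set B := [set x | exists j k, [/\ J j, K k & x = j + k]].

Let idJ : is_ideal J.
Proof.
split=> [|x y Jx Jy|b x Jx]; rewrite /J /= ?mul0r //.
  by rewrite mulrDl Jx Jy addr0.
by rewrite -mulrA Jx mulr0.
Qed.

Let idK : is_ideal K.
Proof.
split=> [j _|x y Kx Ky j Jj|b x Kx j Jj]; first by rewrite mulr0.
  by rewrite mulrDr Kx ?Ky ?addr0.
by rewrite mulrCA Kx ?mulr0.
Qed.

Let idI : is_ideal I.
Proof.
split=> [|_ _ [j [k [Jj Kk ->]]] [j' [k' [Jj' Kk' ->]]]|b _ [j [k [Jj Kk ->]]]].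
- by exists 0, 0; rewrite addr0; split=> //; apply: ideal0.
- by exists (j + j'), (k + k'); rewrite addrACA; split=> //;
    [apply: (idealD idJ) | apply: (idealD idK)].
- by exists (b * j), (b * k); rewrite mulrDr; split=> //;
    [apply: (idealMl _ idJ) | apply: (idealMl _ idK)].
Qed.

Let JI j : J j -> I j.
Proof. by move=> Jj; exists j, 0; rewrite addr0; split=> //; apply: ideal0. Qed.
Let KI k : K k -> I k.
Proof. by move=> Kk; exists 0, k; rewrite add0r; split=> //; apply: ideal0. Qed.

Let JKI x : J x -> K x -> x = 0.
Proof. by move=> Jx Kx; apply: serre_reduced; apply: Kx. Qed.

(* J is finitely generated, so one denominator serves all of J. *)
Let local_K (q : spec B) w : (forall j, J j -> local_zero q (j * w)) ->
  exists2 s, ~ prime_val q s & K (s * w).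
Proof.
move=> Jw; have [n [g gJ]] := noethB idJ.
have Jg i : J (g i).
  rewrite gJ; exists (fun j => (j == i)%:R); rewrite (bigD1 i) //= eqxx mul1r.
  by rewrite big1 ?addr0 // => j /negPf->; rewrite mul0r.
have /choice[s sP] i : exists s, ~ prime_val q s /\ s * (g i * w) = 0.
  by have [s] := Jw _ (Jg i); exists s.
exists (\prod_i s i); first by apply: prime_prodN => i _; apply: (sP i).1.
move=> j; rewrite gJ => -[c ->]; rewrite mulr_suml big1 // => i _.
rewrite (bigD1 i) //=; move: (\prod_(_ < n | _) _) => P.
rewrite [LHS](_ : _ = c i * P * (s i * (g i * w))); last by ring.
by rewrite (sP i).2 mulr0.
Qed.

(** Locally at [q], [t] is [j / x + k / x]. Cancelling the regular [x] shows that the fractions lie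
    locally in [J] and [K], so some element outside [q] multiplies [t] into [I]. *)
Let dvd_absurd (q : spec B) t x j k :
  (forall s, prime_val q s <-> I (s * t)) -> (forall u, x * u = 0 -> local_zero q u) ->
  J j -> K k -> x * t = j + k -> local_dvd q x j -> local_dvd q x k -> False.
Proof.
move=> qE xreg Jj Kk xt [s qs [w sj]] [s' qs' [w' sk]].
have [s3 qs3 Jw] : local_zero q (w * a).
  by apply: xreg; rewrite mulrA -sj -mulrA Jj mulr0.
have [s4 qs4 Kw'] : exists2 s, ~ prime_val q s & K (s * w').
  apply: local_K => j' Jj'; apply: xreg.
  by rewrite mulrCA -sk mulrCA (Kk _ Jj') mulr0.
have [s5 qs5 e] : local_zero q (s * s' * t - (s' * w + s * w')).
  apply: xreg; rewrite mulrBr mulrDr !(mulrCA x) -sj -sk xt.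
  by ring.
have : prime_val q (s3 * s4 * s5 * (s * s')); last first.
  by do !apply: prime_mulN.
apply/qE.
have -> : s3 * s4 * s5 * (s * s') * t =
    s4 * s5 * s' * (s3 * w) + s3 * s5 * s * (s4 * w').
  rewrite [LHS](_ : _ = s3 * s4 * (s5 * (s * s' * t - (s' * w + s * w'))) +
    (s4 * s5 * s' * (s3 * w) + s3 * s5 * s * (s4 * w'))); last by ring.
  by rewrite e mulr0 add0r.
apply: (idealD idI); apply: (idealMl _ idI); last exact: KI.
by apply: JI; rewrite /J /= -mulrA.
Qed.

(** If [I] is the unit ideal, locality makes an element of [J] or of [K] invertible, which kills [a]
    or [b]. Otherwise an associated prime [q] of [I] exists, and every form of [serre_prime] at [q]
    is contradictory. *)
Lemma serre_regular (b : B) : b * a = 0 -> a = 0 \/ b = 0.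
Proof.
move=> ba.
have [[j [k [Jj Kk /esym/localB[] [z zE]]]]|] := pselect (I 1).
- by left; rewrite -[a]mul1r -zE -mulrA Jj mulr0.
- by right; rewrite -[b]mul1r -zE -mulrA [k * b]mulrC Kk ?mulr0.
case/(associated_prime noethB idI) => q [r].
move: (r * 1) => t qE; exfalso.
have Iq x : I x -> prime_val q x by move=> Ix; apply/qE; apply: (idealMr _ idI).
case: (serreB q) => [x y qx qy xreg xyreg|qzero|y qy yreg qdvd].
- have [j1 [k1 [Jj1 Kk1 e1]]] := (qE x).1 qx.
  have [j2 [k2 [Jj2 Kk2 e2]]] := (qE y).1 qy.
  (* The left side lies in [J] and the right side in [K], so both vanish. The two resulting
     equations make [x] divide [j1] and [k1] locally. *)
  have e : y * j1 - x * j2 = x * k2 - y * k1.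
    have -> : j1 = x * t - k1 by rewrite e1 addrK.
    have -> : j2 = y * t - k2 by rewrite e2 addrK.
    by ring.
  have e0 : y * j1 - x * j2 = 0.
    apply: JKI; first by apply: (idealB idJ); apply: (idealMl _ idJ).
    by rewrite e; apply: (idealB idK); apply: (idealMl _ idK).
  apply: (dvd_absurd qE xreg Jj1 Kk1 e1).
    by apply: (xyreg _ j2); apply/eqP; rewrite -subr_eq0 e0.
  by apply: (xyreg _ k2); apply/esym/eqP; rewrite -subr_eq0 -e e0.
(* [J] lies in [q], hence vanishes locally, so an element outside [q] lies in [K], although [K] is
   inside [q]. *)
- have [|s qs Ks] := @local_K q 1.
    by move=> j Jj; rewrite mulr1; apply: qzero; apply/Iq/JI.
  by apply: qs; apply/Iq/KI; rewrite -[s]mulr1.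
- have [j [k [Jj Kk e]]] := (qE y).1 qy.
  by apply: (dvd_absurd qE yreg Jj Kk e); apply/qdvd/Iq; [apply: JI | apply: KI].
Qed.

End ZeroDivisor.

Lemma serre_domain (a b : B) : a * b = 0 -> a = 0 \/ b = 0.
Proof. by move/serre_regular; case; [right | left]. Qed.

Lemma serre_mulfI (x u v : B) : x <> 0 -> x * u = x * v -> u = v.
Proof.
move=> x0 /eqP; rewrite -subr_eq0 -mulrBr => /eqP/serre_domain[//|/eqP].
by rewrite subr_eq0 => /eqP.
Qed.

(* The relation says that a / b is a root of a monic polynomial. *)
Lemma serre_integrally_closed (a b : B) n (c : nat -> B) : b <> 0 ->
  a ^+ n = \sum_(i < n) c i * a ^+ i * b ^+ (n - i) -> exists z, a = b * z.
Proof.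
move=> b0 rel; pose I : set B := [set x | exists z, x = b * z].
have idI : is_ideal I.
  split=> [|_ _ [z ->] [w ->]|d _ [z ->]]; first by exists 0; rewrite mulr0.
    by exists (z + w); rewrite mulrDr.
  by exists (d * z); rewrite mulrCA.
apply: contrapT => /(associated_prime noethB idI)[q [r]].
have {rel} : (r * a) ^+ n = \sum_(i < n) c i * r ^+ (n - i) * (r * a) ^+ i * b ^+ (n - i).
  rewrite exprMn rel mulr_sumr; apply: eq_bigr => i _.
  have -> : r ^+ n = r ^+ (n - i) * r ^+ i.
    by rewrite -exprD (subnK (ltnW (ltn_ord i))).
  by rewrite exprMn; ring.
move: (r * a) => t rel qE.
have q0 : prime_val q 0 by apply: ideal0 (prime_ideal q).
have reg_neq0 x : (forall u, x * u = 0 -> local_zero q u) -> x <> 0.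
  move=> xreg x0; have [|s qs] := xreg 1; first by rewrite x0 mul0r.
  by rewrite mulr1 => s0; rewrite s0 in qs.
case: (serreB q) => [x y qx qy xreg xyreg|qzero|y qy yreg qdvd].
(* Eliminating [t] from [x t = b w] and [y t = b v] gives [y w = x v]. So [x] divides [w] locally,
   and then [b] divides [t] locally. *)
- have [[w xt] [v yt]] := ((qE x).1 qx, (qE y).1 qy).
  have [|s qs [z sw]] := xyreg w v.
    by apply: (serre_mulfI b0); rewrite ![b * _]mulrCA -xt -yt mulrCA.
  apply/qs/qE; exists z; apply: (serre_mulfI (reg_neq0 _ xreg)).
  by rewrite mulrCA xt mulrCA sw mulrCA.
- have [|s qs] := qzero b; first by apply/qE; exists t.
  by move=> /serre_domain[s0|//]; rewrite s0 in qs.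
- have [w yt] := (qE y).1 qy.
  (* Here [t / b = w / y]. If [w] lies in [q], then [y] divides it locally and [b] divides [t]
     locally; otherwise the integral relation for [w / y] forces a power of [w] into [q]. *)
  have [qw|qw] := pselect (prime_val q w).
    have [s qs [z sw]] := qdvd _ qw.
    apply/qs/qE; exists z; apply: (serre_mulfI (reg_neq0 _ yreg)).
    by rewrite mulrCA yt mulrCA sw mulrCA.
  apply/qw/(@prime_exp _ _ _ n).
  have bn0 : b ^+ n <> 0.
    elim: (n) => [|m IHm]; rewrite ?expr0 ?exprS; last by move/serre_domain => [].
    by move=> e; apply: b0; rewrite -[b]mul1r e mul0r.
  suff -> : w ^+ n = \sum_(i < n) c i * r ^+ (n - i) * w ^+ i * y ^+ (n - i).
    apply: ideal_sum (prime_ideal q) _ => i _; apply: (idealMl _ (prime_ideal q)).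
    by rewrite -(subnSK (ltn_ord i)) exprS; apply: (idealMr _ (prime_ideal q)).
  apply: (serre_mulfI bn0); rewrite -exprMn -yt exprMn rel !mulr_sumr.
  apply: eq_bigr => i _.
  have expE d : d ^+ n = d ^+ (n - i) * d ^+ i :> B.
    by rewrite -exprD (subnK (ltnW (ltn_ord i))).
  rewrite (expE y) (expE b) [LHS](_ : _ = c i * r ^+ (n - i) * (y * t) ^+ i *
    y ^+ (n - i) * b ^+ (n - i)); last by rewrite exprMn; ring.
  by rewrite yt exprMn; ring.
Qed.

End SerreLocalRing.

(** * From elementwise conditions to an integrally closed domain *)

Section DomainStructure.
Variable B : comPzRingType.
Hypothesis B_nonzero : (1 : B) <> 0.
Hypothesis B_integral : forall x y : B, x * y = 0 -> x = 0 \/ y = 0.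

Definition domain_copy : Type := B.
HB.instance Definition _ := GRing.ComPzRing.on domain_copy.

Fact domain_copy_neq0 : (1 : domain_copy) != 0.
Proof. exact/eqP. Qed.
HB.instance Definition _ :=
  GRing.PzSemiRing_isNonZero.Build domain_copy domain_copy_neq0.

Definition copy_unit : pred domain_copy := fun x => `[< exists y, y * x = 1 >].
Definition copy_inv (x : domain_copy) : domain_copy :=
  if pselect (exists y, y * x = 1) is left h then sval (cid h) else x.
Fact copy_mulVx : {in copy_unit, left_inverse 1 copy_inv *%R}.
Proof.
by move=> x /asboolP xU; rewrite /copy_inv; case: pselect => // h; case: cid.
Qed.
Fact copy_unitPl x y : y * x = 1 -> copy_unit x.
Proof. by move=> yx; apply/asboolP; exists y. Qed.
Fact copy_invr_out : {in [predC copy_unit], copy_inv =1 id}.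
Proof. by move=> x /asboolP xU; rewrite /copy_inv; case: pselect. Qed.
HB.instance Definition _ := GRing.ComNzRing_hasMulInverse.Build domain_copy
  copy_mulVx copy_unitPl copy_invr_out.

Fact copy_integral (x y : domain_copy) : x * y = 0 -> (x == 0) || (y == 0).
Proof. by move/B_integral => [] ->; rewrite eqxx ?orbT. Qed.
HB.instance Definition _ :=
  GRing.ComUnitRing_isIntegral.Build domain_copy copy_integral.

(** An integral fraction is written [a / b] and its monic equation of degree [n] is multiplied by
    [b ^+ n]; the hypothesis then makes [b] divide [a]. *)
Lemma integrally_closed_domain_intro :
  (forall (a b : B) n (c : nat -> B), b <> 0 ->
    a ^+ n = \sum_(i < n) c i * a ^+ i * b ^+ (n - i) -> exists z, a = b * z) ->
  integrally_closed_domain B.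
Proof.
move=> closedB; exists domain_copy, (idfun : {rmorphism B -> domain_copy}).
split=> [|x]; first by exists id.
have {}closedB (a b : domain_copy) n (c : nat -> domain_copy) : b <> 0 ->
    a ^+ n = \sum_(i < n) c i * a ^+ i * b ^+ (n - i) -> exists z, a = b * z.
  exact: closedB.
pose F := @tofrac domain_copy.
have [a [b [b0 xE]]] : exists a b, b != 0 /\ x = F a / F b.
  elim/quotW: x => r; exists (fraction.frac r).1, (fraction.frac r).2.
  split; first exact: denom_ratioP.
  have Fd0 : F (fraction.frac r).2 != 0 by rewrite tofrac_eq0 denom_ratioP.
  apply: (mulIf Fd0); rewrite divfK // /F; unlock tofrac; rewrite -[LHS]FracField.pi_mul.
  apply/eqmodP; rewrite /= FracField.equivfE /FracField.mulf.
  by rewrite !numden_Ratio ?mulf_neq0 ?oner_neq0 ?denom_ratioP // !mulr1 mulrC.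
have Fb0 : F b != 0 by rewrite tofrac_eq0.
move=> [p p_monic /rootP px].
have [z az] : exists z, a = b * z :> domain_copy.
  apply: (closedB a b (size p).-1 (fun i => - p`_i)); first exact/eqP.
  set n := (size p).-1.
  have sp : size p = n.+1 by rewrite prednK // lt0n size_poly_eq0 monic_neq0.
  move: px; rewrite (horner_coef_wide _ (size_poly _ _)) sp big_ord_recr /=.
  rewrite coef_poly ltnSn -[p`_n]/(lead_coef p) (monicP p_monic) tofrac1 mul1r.
  move=> /eqP; rewrite addrC addr_eq0 => /eqP px.
  have xb i : x ^+ i * F b ^+ i = F a ^+ i by rewrite -exprMn xE divfK.
  apply/eqP; rewrite -tofrac_eq; apply/eqP.
  rewrite -/F [LHS]tofracXn -/F -xb px mulNr mulr_suml -sumrN /F rmorph_sum -/F /=.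
  apply: eq_bigr => i _; rewrite coef_poly ltnS (ltnW (ltn_ord i)).
  rewrite -!/(F _) /F !tofracM tofracN !tofracXn -!/(F _) -xb.
  have -> : F b ^+ n = F b ^+ (n - i) * F b ^+ i.
    by rewrite -exprD (subnK (ltnW (ltn_ord i))).
  by ring.
by exists z; rewrite xE az /F tofracM mulrAC mulfV ?mul1r.
Qed.

End DomainStructure.

(** * Localization *)

Section LocalizationFacts.
Variables (R : comPzRingType) (S : mult_set R).

Lemma frac_eq0 (M : lmodType R) (m : M) (s : S) :
  frac m s = 0 <-> exists u : S, sval u *: m = 0.
Proof.
rewrite -[0]/(frac 0 (denom1 S)); split=> [/frac_eq[u]|[u um]].
  by rewrite /= scale1r !scaler0 => um; exists u.
by apply/frac_eq; exists u; rewrite /= scale1r !scaler0.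
Qed.

Section Structure.
Variable A : pzAlgType R.

Definition loc_str (r : R) : loc_alg S A := frac (alg_str r : algmod A) (denom1 S).

Fact loc_str_zmod : zmod_morphism loc_str.
Proof.
move=> a b; rewrite [- loc_str b]loc_oppE [RHS]loc_addE.
by apply: frac_congr; rewrite /= rmorphB !scale1r mulr1 scale1r.
Qed.
Fact loc_str_monoid : monoid_morphism loc_str.
Proof.
split=> [|a b]; first by rewrite /loc_str rmorph1.
by rewrite [RHS]loc_mulE; apply: frac_congr; rewrite /= rmorphM mulr1.
Qed.
HB.instance Definition _ :=
  GRing.isZmodMorphism.Build R (loc_alg S A) loc_str loc_str_zmod.
HB.instance Definition _ :=
  GRing.isMonoidMorphism.Build R (loc_alg S A) loc_str loc_str_monoid.

Lemma loc_strM r (x : A) s :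
  loc_str r * (frac (x : algmod A) s : loc_alg S A) = frac (r *: (x : algmod A)) s.
Proof. by rewrite [LHS]loc_mulE; apply: frac_congr; rewrite /= mul1r. Qed.

Lemma loc_strC r (z : loc_alg S A) : loc_str r * z = z * loc_str r.
Proof.
case: (fracP z) => x s; rewrite [LHS]loc_mulE [RHS]loc_mulE; apply: frac_congr => /=.
by rewrite alg_strC mul1r mulr1.
Qed.

End Structure.

Definition loc_of (r : R) : loc_ring S := loc_str R^o r.
HB.instance Definition _ := GRing.RMorphism.copy loc_of (loc_str R^o).

Lemma rfrac_surj (x : loc_ring S) : exists a s, x = rfrac a s.
Proof. by case: (fracP x) => a s; exists a, s. Qed.

Lemma rfracM (a b : R) (s t : S) :
  rfrac a s * rfrac b t = rfrac (a * b) (denomM s t).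
Proof. exact: loc_mulE. Qed.

Lemma rfrac_eq (a b : R) (s t : S) :
  rfrac a s = rfrac b t <-> exists u : S, sval u * (sval t * a) = sval u * (sval s * b).
Proof. exact: frac_eq. Qed.

Lemma rfrac_eq0 (a : R) (s : S) : rfrac a s = 0 <-> exists u : S, sval u * a = 0.
Proof. exact: frac_eq0. Qed.

Lemma loc_ofM r (a : R) (s : S) : loc_of r * rfrac a s = rfrac (r * a) s.
Proof. exact: (@loc_strM R^o). Qed.

Lemma loc_of_unit (s : S) : rfrac 1 s * loc_of (sval s) = 1.
Proof.
rewrite mulrC loc_ofM; apply/rfrac_eq; exists (denom1 S).
by rewrite /= mul1r !mulr1.
Qed.

Lemma rfracE (a : R) (s : S) : rfrac a s = rfrac 1 s * loc_of a.
Proof. by rewrite mulrC loc_ofM mulr1. Qed.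

(** The contraction of [I] to [R] is finitely generated, and a fraction [a / s] in [I] is [1 / s]
    times the image of [a], which lies in the contraction. *)
Lemma loc_noetherian : noetherian R -> noetherian (loc_ring S).
Proof.
move=> noethR I idI; have [|n [g gI]] := noethR [set a | I (loc_of a)].
  split=> [|a b Ia Ib|a b Ib]; rewrite /= ?rmorph0 ?rmorphD ?rmorphM.
  - exact: ideal0.
  - exact: (idealD idI).
  - exact: (idealMl _ idI).
exists n, (fun i => loc_of (g i)); apply/seteqP; split=> [x Ix|_ [c ->]].
  have [a [s xE]] := rfrac_surj x.
  have : I (loc_of a).
    rewrite -[loc_of a]mul1r -(loc_of_unit s) mulrAC -rfracE -xE.
    exact: (idealMr _ idI).
  rewrite -[I _]/([set a | I (loc_of a)] a) gI => -[c aE].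
  exists (fun i => rfrac (c i) s); rewrite xE rfracE aE rmorph_sum mulr_sumr.
  by apply: eq_bigr => i _; rewrite rmorphM mulrA -rfracE.
apply: (ideal_sum (I := I)) => // i _; apply: (idealMl _ idI).
rewrite -[I _]/([set a | I (loc_of a)] (g i)) gI.
exists (fun j => (j == i)%:R); rewrite (bigD1 i) //= eqxx mul1r.
by rewrite big1 ?addr0 // => j /negPf->; rewrite mul0r.
Qed.

Section Contraction.
Variable q : spec (loc_ring S).

(** Closing with [Defined] keeps the underlying set transparent, so that membership of [a] unfolds
    to membership of [loc_of a] in [q]. *)
Definition contraction : spec R.
Proof.
exists [set a | prime_val q (loc_of a)].
- split=> [|a b qa qb|a b qb]; rewrite /= ?rmorph0 ?rmorphD ?rmorphM.
  + exact: ideal0 (prime_ideal q).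
  + exact: (idealD (prime_ideal q)).
  + exact: (idealMl _ (prime_ideal q)).
- by rewrite /= rmorph1; apply: prime_proper.
- by move=> a b; rewrite /= rmorphM => /primeP.
Defined.

Lemma contraction_denom (s : S) : ~ prime_val contraction (sval s).
Proof.
move=> qs; apply: (@prime_proper _ q); rewrite -(loc_of_unit s).
exact: (idealMl _ (prime_ideal q)).
Qed.

Lemma local_zero_loc (a : R) (s : S) :
  local_zero contraction a -> local_zero q (rfrac a s).
Proof.
case=> t qt ta; exists (loc_of t) => //; rewrite loc_ofM ta; apply/rfrac_eq0.
by exists (denom1 S); rewrite mulr0.
Qed.

Lemma local_dvd_loc (y a : R) (s : S) :
  local_dvd contraction y a -> local_dvd q (loc_of y) (rfrac a s).
Proof.
case=> t qt [w ta]; exists (loc_of t) => //; exists (rfrac w s).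
by rewrite !loc_ofM ta.
Qed.

Lemma regular_loc (y : R) :
  (forall u, y * u = 0 -> local_zero contraction u) ->
  forall u, loc_of y * u = 0 -> local_zero q u.
Proof.
move=> yreg u; have [a [s ->]] := rfrac_surj u; rewrite loc_ofM => /rfrac_eq0[v].
rewrite mulrCA => /yreg[t qt]; rewrite mulrA => tva; apply: local_zero_loc.
by exists (t * sval v) => //; apply: prime_mulN => //; apply: contraction_denom.
Qed.

Lemma contraction_frac (a : R) (s : S) :
  prime_val q (rfrac a s) -> prime_val contraction a.
Proof.
move=> qa; rewrite /= -[loc_of a]mul1r -(loc_of_unit s) mulrAC -rfracE.
exact: (idealMr _ (prime_ideal q)).
Qed.

(** Localizing [loc_ring S] at [q] amounts to localizing [R] at the contraction, and [serre_prime]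
    describes only that local ring. The images of the same elements serve as witnesses. *)
Lemma serre_prime_loc : serre_prime contraction -> serre_prime q.
Proof.
case=> [x y qx qy xreg xyreg|qzero|y qy yreg qdvd].
- apply: (SerreDepth2 (x := loc_of x) (y := loc_of y)) => //.
    exact: regular_loc.
  move=> u v; have [a [s ->]] := rfrac_surj u; have [b [t ->]] := rfrac_surj v.
  rewrite !loc_ofM => /rfrac_eq[w e]; apply: local_dvd_loc.
  (* Equality of fractions holds only up to the factor [w]; absorbing it together with the
     denominators gives an equation in [R]. *)
  have [|r qr [z rz]] := xyreg (sval w * sval t * a) (sval w * sval s * b).
    rewrite [LHS](_ : _ = sval w * (sval t * (y * a))); last by ring.
    by rewrite e; ring.
  exists (r * (sval w * sval t)); last by exists z; rewrite -rz !mulrA.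
  by do 2!(apply: prime_mulN => //); apply: contraction_denom.
- apply: SerreField => u; have [a [s ->]] := rfrac_surj u.
  by move=> /contraction_frac qa; apply/local_zero_loc/qzero.
- apply: (SerreValuation (y := loc_of y)) => //; first exact: regular_loc.
  move=> u; have [a [s ->]] := rfrac_surj u.
  by move=> /contraction_frac qa; apply/local_dvd_loc/qdvd.
Qed.

End Contraction.

End LocalizationFacts.

Section LocalizationAtPrimeFacts.
Variables (R : comPzRingType) (p : spec R).

Lemma prime_complE (s : prime_compl p) : ~ prime_val p (sval s).
Proof. by have := valP s; rewrite inE. Qed.

Definition prime_denom (a : R) (pa : ~ prime_val p a) : prime_compl p :=
  exist _ a (mem_set pa).

Lemma ring_at_unit (a : R) (s : prime_compl p) : ~ prime_val p a ->
  exists z : ring_at p, z * rfrac a s = 1.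
Proof.
move=> pa; exists (rfrac (sval s) (prime_denom pa)); rewrite rfracM; apply/rfrac_eq.
by exists (denom1 _); rewrite /= !mul1r mulr1 mulrC.
Qed.

Lemma ring_at_nonunit (a b : R) (s t : prime_compl p) :
  prime_val p a -> prime_val p b -> rfrac a s + rfrac b t <> 1.
Proof.
move=> pa pb; rewrite [_ + _]loc_addE => /rfrac_eq[u] /=; rewrite mul1r mulr1 => e.
have : prime_val p (sval u * (sval s * sval t)).
  rewrite -e; apply: (idealMl _ (prime_ideal p)).
  by apply: (idealD (prime_ideal p)); apply: (idealMl _ (prime_ideal p)).
by do 2!(apply: prime_mulN; first exact: prime_complE); apply: prime_complE.
Qed.

Lemma ring_at_local (x y : ring_at p) : x + y = 1 ->
  (exists z, z * x = 1) \/ (exists z, z * y = 1).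
Proof.
have [a [s ->]] := rfrac_surj x; have [b [t ->]] := rfrac_surj y => xy.
have [pa|pa] := pselect (prime_val p a); last by left; apply: ring_at_unit.
right; apply: ring_at_unit => pb; exact: ring_at_nonunit pa pb xy.
Qed.

Lemma maximal_at_ideal : is_ideal (maximal_at (p := p)).
Proof.
split=> [|_ _ [a [s [pa ->]]] [b [t [pb ->]]]|x _ [a [s [pa ->]]]].
- by exists 0, (denom1 _); split=> //; apply: ideal0 (prime_ideal p).
- exists (sval t * a + sval s * b), (denomM s t); split; last exact: loc_addE.
  by apply: (idealD (prime_ideal p)); apply: (idealMl _ (prime_ideal p)).
- have [b [t ->]] := rfrac_surj x; exists (b * a), (denomM t s); rewrite rfracM.
  by split=> //; apply: (idealMl _ (prime_ideal p)).
Qed.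

(** One of [x] and [1 - x] is a unit, and a unit in the maximal ideal would make 1 a fraction with
    numerator in [p]. This is the Jacobson radical condition of [nakayama]. *)
Lemma maximal_at_unit x : maximal_at x -> exists z : ring_at p, z * (1 - x) = 1.
Proof.
move=> xm; have [|[z zx]|//] := @ring_at_local x (1 - x).
  by rewrite addrC subrK.
have [_ _ /(_ z _ xm)] := maximal_at_ideal; rewrite zx => -[a [s [pa e]]].
case: (@ring_at_nonunit a 0 s (denom1 _)) => //; first exact: ideal0 (prime_ideal p).
have -> : rfrac 0 (denom1 (prime_compl p)) = 0.
  by apply/rfrac_eq0; exists (denom1 _); rewrite mulr0.
by rewrite addr0 -e.
Qed.

Lemma ring_at_neq0 : (1 : ring_at p) <> 0.
Proof.
move=> /(@rfrac_eq0 _ _ 1 (denom1 _))[u]; rewrite mulr1 => u0.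
apply: (prime_complE (s := u)); rewrite u0; exact: ideal0 (prime_ideal p).
Qed.

End LocalizationAtPrimeFacts.

(** * Orders in which the base ring splits off *)

Lemma nat_infP (P : set nat) n : nat_inf P = n%:E%E -> P n.
Proof.
rewrite /nat_inf; case: pselect => // exP [<-].
by case: ex_minnP => m /asboolP.
Qed.

(** If all members were at most 1, the least upper bound would be 0 or 1. The argument also covers
    an infinite supremum. *)
Lemma nat_sup_gt1 (P : set nat) : nat_sup P <> -oo%E -> nat_sup P <> 0%:E%E ->
  nat_sup P <> 1%:E%E -> exists2 n, P n & (1 < n)%N.
Proof.
rewrite /nat_sup; case: pselect => [P_ne|//] _ /= n0 n1; apply: contrapT => P1.
have le1 m : P m -> (m <= 1)%N.
  by move=> Pm; rewrite leqNgt; apply/negP => m1; apply: P1; exists m.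
move: n0 n1; rewrite /nat_inf; case: pselect => [exP|]; last first.
  by case; exists 1%N; apply/asboolP.
case: ex_minnP => m _ m_min; have : (m <= 1)%N by apply/m_min/asboolP.
by case: m {m_min} => [|[]].
Qed.

(** Elimination: the last equation is solved for the last unknown, because [1 - c l l] is
    invertible, and substituted into the others, whose coefficients stay in [m]. *)
Lemma nakayama (B : comPzRingType) (m : set B) n (x : 'I_n -> B)
    (c : 'I_n -> 'I_n -> B) : is_ideal m ->
  (forall a, m a -> exists b, b * (1 - a) = 1) -> (forall i j, m (c i j)) ->
  (forall i, x i = \sum_j c i j * x j) -> forall i, x i = 0.
Proof.
move=> idm m1; elim: n x c => [x c _ _ []//|n IHn x c mc xE].
pose x' i := x (lift ord_max i); pose l := @ord_max n.
have xE' i : x i = \sum_j c i (lift l j) * x' j + c i l * x l.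
  rewrite {1}xE big_ord_recr /=; congr (_ + _); apply: eq_bigr => j _.
  by rewrite /x' (_ : widen_ord _ j = lift l j) //; apply/val_inj/esym/lift_max.
have [b bE] := m1 _ (mc l l).
have xl : x l = b * \sum_j c l (lift l j) * x' j.
  have e : (1 - c l l) * x l = \sum_j c l (lift l j) * x' j.
    by rewrite mulrBl mul1r {1}xE' addrK.
  by rewrite -e mulrA bE mul1r.
have x'0 : forall i, x' i = 0.
  apply: (IHn x' (fun i j => c (lift l i) (lift l j) +
    c (lift l i) l * b * c l (lift l j))) => [i j|i].
    by apply: (idealD idm) => //; apply: (idealMl _ idm).
  rewrite {1}/x' xE' xl mulrA mulr_sumr -big_split /=.
  by apply: eq_bigr => j _; rewrite mulrDl !mulrA.
move=> i; have [j ->|->] := unliftP l i; first exact: x'0.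
by rewrite xl big1 ?mulr0 // => j _; rewrite x'0 mulr0.
Qed.

Section SplitAlgebra.
Variables (R : comPzRingType) (A : pzAlgType R).
Variable tau : algmod A -> R.
Hypothesis tauD : forall a b, tau (a + b) = tau a + tau b.
Hypothesis tauZ : forall r a, tau (r *: a) = r * tau a.
Hypothesis tau1 : tau (1 : A) = 1.

Let tau0 : tau 0 = 0.
Proof. by rewrite -(scale0r 0) tauZ mul0r. Qed.

Definition loc_tau (S : mult_set R) (z : loc_alg S A) : loc_ring S :=
  rfrac (tau (repr z).1) (repr z).2.

Lemma loc_tauE (S : mult_set R) (a : algmod A) (s : S) :
  loc_tau (frac a s) = rfrac (tau a) s.
Proof.
have [u e] := repr_frac a s; apply/rfrac_eq; exists u.
by have := congr1 tau e; rewrite !tauZ.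
Qed.

Lemma loc_tauD (S : mult_set R) (x y : loc_alg S A) :
  loc_tau (x + y) = loc_tau x + loc_tau y.
Proof.
case: (fracP x) => a s; case: (fracP y) => b t.
rewrite [_ + _]loc_addE !loc_tauE tauD !tauZ [RHS]loc_addE.
by [].
Qed.

Lemma loc_tau_str (S : mult_set R) r (z : loc_alg S A) :
  loc_tau (loc_str S A r * z) = loc_of S r * loc_tau z.
Proof. by case: (fracP z) => a s; rewrite loc_strM !loc_tauE loc_ofM tauZ. Qed.

Lemma loc_tau0 (S : mult_set R) : loc_tau (0 : loc_alg S A) = 0.
Proof. by rewrite [LHS]loc_tauE tau0. Qed.

Lemma loc_tau_sum (S : mult_set R) (T : finType) (F : T -> loc_alg S A) :
  loc_tau (\sum_i F i) = \sum_i loc_tau (F i).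
Proof. exact: (big_morph _ (@loc_tauD S) (loc_tau0 S)). Qed.

Lemma loc_tau_one (S : mult_set R) r : loc_tau (loc_str S A r) = loc_of S r.
Proof.
have -> : loc_str S A r = loc_str S A r * 1 by rewrite mulr1.
by rewrite loc_tau_str [loc_tau 1]loc_tauE tau1 mulr1.
Qed.

Variable p : spec R.
Let S := prime_compl p.

(** The numerators of the first two terms serve as witnesses. A relation in [R] is moved to
    multiples of the unit of [A], regularity is used there, and [tau] brings the conclusion back. *)
Lemma depth2_serre x n : (1 < n)%N ->
  (forall k, (k < n)%N -> maximal_at (p := p) (x k)) ->
  regular_seq (module_at p (algmod A)) x n -> serre_prime p.
Proof.
move=> n1 xp [xreg _].
have [a [s [pa xa]]] := xp 0%N (ltnW n1); have [b [t [pb xb]]] := xp 1%N n1.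
(* As sums of [k] terms, [seq_submod x 0] is zero and [seq_submod x 1] consists of the multiples of
   [x 0]. *)
have reg0 v : x 0%N *: v = 0 -> v = 0 :> module_at p (algmod A).
  move=> xv; have [|w ->] := xreg 0%N v (ltnW n1); last by rewrite big_ord0.
  by exists (fun=> 0); rewrite big_ord0.
have reg1 v w : x 1%N *: v = x 0%N *: w :> module_at p (algmod A) ->
    exists w', v = x 0%N *: w'.
  move=> e; have [|w' ->] := xreg 1%N v n1; last by exists (w' ord0); rewrite big_ord1.
  by exists (fun=> w); rewrite big_ord1.
pose e1 : algmod A := (1 : A).
apply: (SerreDepth2 (x := a) (y := b)) => // [u au|u v e].
  have /frac_eq0[w /(congr1 tau)] :
      frac (u *: e1) (denom1 S) = 0 :> module_at p (algmod A).
    apply: reg0; rewrite xa [LHS]loc_scaleE scalerA au scale0r; apply/frac_eq0.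
    by exists (denom1 S); rewrite scaler0.
  rewrite !tauZ tau1 mulr1 tau0 => wu; exists (sval w) => //.
  exact: prime_complE.
(* With [x 0 = a / s] and [x 1 = b / t], the factors [t] and [s] cancel the denominators, which
   leaves [b * u = a * v]. *)
have [|z] := reg1 (frac (sval t * u *: e1) (denom1 S))
                  (frac (sval s * v *: e1) (denom1 S)).
  rewrite xa xb; apply: etrans (loc_scaleE _ _ _ _) _.
  apply: etrans _ (esym (loc_scaleE _ _ _ _)); apply: frac_congr => /=.
  rewrite !scalerA; congr (_ *: _).
  rewrite [LHS](_ : _ = sval s * sval t * (b * u)); last by ring.
  by rewrite e; ring.
case: (fracP z) => m r; rewrite xa => /esym/(etrans (esym (loc_scaleE _ _ _ _)))/esym.
case/frac_eq => w /(congr1 tau) /=.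
rewrite !tauZ tau1 => e'.
exists (sval w * (sval s * sval r) * sval t).
  by do !apply: prime_mulN => //; apply: prime_complE.
exists (sval w * tau m).
rewrite [LHS](_ : _ = sval w * (sval s * sval r * (sval t * u * 1))); last by ring.
by rewrite e'; ring.
Qed.

(** The images [c i j] under [tau] of a dual basis of the ideal generated by [p] in the localized
    algebra form one for the maximal ideal of [ring_at p]. If some [c i j] is a unit, [x i] is
    regular and generates locally; if none is, Nakayama's lemma makes the ideal zero. *)
Lemma hereditary_serre : noetherian R ->
  (forall N : lmodType (algebra_at p A), has_proj_resolution_le N 1) -> serre_prime p.
Proof.
move=> noethR gldim1; have [n [x xE]] := noethR _ (prime_ideal p).
have px i : prime_val p (x i).
  rewrite xE; exists (fun j => (j == i)%:R); rewrite (bigD1 i) //= eqxx mul1r.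
  by rewrite big1 ?addr0 // => j /negPf->; rewrite mul0r.
have [sigma [sigmaE sigma0]] := ideal_dual_basis
  (iota := loc_str S A : {rmorphism R -> loc_alg S A}) (@loc_strC R S A) x gldim1.
pose c i j := loc_tau (sigma i j).
have cE i : loc_of S (x i) = \sum_j c i j * loc_of S (x j).
  rewrite -loc_tau_one sigmaE loc_tau_sum; apply: eq_bigr => j _.
  by rewrite loc_tau_str mulrC.
have c0 r : \sum_i r i * x i = 0 -> forall j, \sum_i loc_of S (r i) * c i j = 0.
  move=> /sigma0 rx j; rewrite -[RHS]loc_tau0 -(rx j) loc_tau_sum.
  by apply: eq_bigr => i _; rewrite loc_tau_str.
have delta (B : comPzRingType) (F : 'I_n -> B) m : \sum_k (k == m)%:R * F k = F m.
  by rewrite (bigD1 m) //= eqxx mul1r big1 ?addr0 // => k /negPf->; rewrite mul0r.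
have [[i [j [a [s [cij pa]]]]]|c_max] :=
    pselect (exists i j a s, c i j = rfrac a s /\ ~ prime_val p a).
  (* The coordinates respect the Koszul relation [x l * x i - x i * x l = 0]. *)
  have swap l : loc_of S (x l) * c i j = loc_of S (x i) * c l j.
    have deltaB (B : comPzRingType) (F : 'I_n -> B) (y z : B) :
        \sum_k ((k == i)%:R * y - (k == l)%:R * z) * F k = y * F i - z * F l.
      rewrite -(delta _ F i) -(delta _ F l) !mulr_sumr -sumrB.
      by apply: eq_bigr => k _; ring.
    have := c0 (fun k => (k == i)%:R * x l - (k == l)%:R * x i).
    rewrite deltaB mulrC subrr => /(_ erefl j).
    under eq_bigr do rewrite rmorphB !rmorphM !rmorph_nat.
    by rewrite (deltaB _ (c^~ j)) => /eqP; rewrite subr_eq0 => /eqP.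
  apply: (SerreValuation (y := x i)) => // [u xu|u pu].
    have := c0 (fun k => (k == i)%:R * u).
    under eq_bigr do rewrite -mulrA.
    rewrite (delta _ (fun k => u * x k)) mulrC => /(_ xu j).
    under eq_bigr do rewrite rmorphM rmorph_nat -mulrA.
    rewrite (delta _ (fun k => loc_of S u * c k j)) cij loc_ofM => /rfrac_eq0[w wua].
    exists (sval w * a); last by rewrite mulrAC -mulrA.
    by apply: prime_mulN => //; apply: prime_complE.
  have [r uE] : exists r : 'I_n -> R, u = \sum_i r i * x i by move: pu; rewrite xE.
  (* The fraction is the [j]-th coordinate of [u]. By [swap], [x i] times it equals [u * c i j], and
     [c i j] is a unit. *)
  have [b [t bt]] := rfrac_surj (\sum_l loc_of S (r l) * c l j).
  have : loc_of S u * c i j = loc_of S (x i) * rfrac b t.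
    rewrite uE -bt rmorph_sum mulr_suml mulr_sumr; apply: eq_bigr => l _.
    by rewrite rmorphM -mulrA swap mulrCA.
  rewrite cij !loc_ofM => /rfrac_eq[w e].
  exists (sval w * sval t * a); first by do !apply: prime_mulN => //; apply: prime_complE.
  exists (sval w * sval s * b).
  rewrite [LHS](_ : _ = sval w * (sval t * (u * a))); last by ring.
  by rewrite e; ring.
have mc i j : maximal_at (c i j).
  have [a [s cij]] := rfrac_surj (c i j); exists a, s; split=> //.
  by apply: contrapT => pa; apply: c_max; exists i, j, a, s.
have x0 i : loc_of S (x i) = 0.
  exact: (nakayama (maximal_at_ideal p) (@maximal_at_unit _ p) mc cE).
apply: SerreField => u pu.
have [r uE] : exists r : 'I_n -> R, u = \sum_i r i * x i by move: pu; rewrite xE.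
have /rfrac_eq0[w wu] : loc_of S u = 0.
  by rewrite uE rmorph_sum big1 // => i _; rewrite rmorphM /= x0 mulr0.
by exists (sval w) => //; apply: prime_complE.
Qed.

(** Global dimension at most 1 is the hereditary case; any other value, infinity included, is a
    depth that supplies a regular sequence of length at least 2. *)
Lemma split_order_serre : noetherian R ->
  depth (module_at p (algmod A)) (maximal_at (p := p)) = gldim (algebra_at p A) ->
  serre_prime p.
Proof.
move=> noethR depthE.
have hereditary n : gldim (algebra_at p A) = n%:E%E -> (n <= 1)%N -> serre_prime p.
  move=> /nat_infP gldim_n n1; apply: hereditary_serre => // N.
  have [P [d [e [projP Pn esurj exact0 exact1]]]] := gldim_n N.
  by exists P, d, e; split=> // i /(leq_ltn_trans n1); apply: Pn.
have [d0|d0] := pselect (gldim (algebra_at p A) = 0%:E%E); first exact: hereditary d0 _.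
have [d1|d1] := pselect (gldim (algebra_at p A) = 1%:E%E); first exact: hereditary d1 _.
have gldim_noo : gldim (algebra_at p A) <> -oo%E.
  by rewrite /gldim /nat_inf; case: pselect.
have [] := @nat_sup_gt1 [set n | exists x : nat -> ring_at p,
  (forall k, (k < n)%N -> maximal_at (x k)) /\
  regular_seq (module_at p (algmod A)) x n]; rewrite -?/(depth _ _) ?depthE //.
by move=> n [x [xp xreg]] n1; apply: depth2_serre xp xreg.
Qed.

End SplitAlgebra.

(** * The retraction onto the base ring given by a generator *)

Section Generator.
Variables (R : comPzRingType) (M : lmodType R).

(** Let [e] be the tuple in [M] that corresponds to [(1, 0)]. An endomorphism acts on the entries of
    [e], and [tau] is the [R]-component of the result; the identity gives back 1. *)
Lemma generator_split : generator M ->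
  exists tau : algmod (endo M) -> R, [/\ forall a b, tau (a + b) = tau a + tau b,
    forall r a, tau (r *: a) = r * tau a & tau (1 : endo M) = 1].
Proof.
move=> [n [K [f [g fK gK]]]].
have gD u v : g (u + v) = g u + g v.
  by apply: (can_inj fK); rewrite linearD !gK.
have gZ r v : g (r *: v) = r *: g v.
  by apply: (can_inj fK); rewrite linearZ /= !gK.
pose e := f (1, 0).
exists (fun a => (g [ffun i => endo_fun a (e i)]).1); split=> [a b|r a|].
- rewrite -[RHS]/((_ + _).1) -gD; congr (g _).1.
  by apply/ffunP => i; rewrite !ffunE.
- rewrite -[RHS]/((r *: g _).1) -gZ; congr (g _).1.
  by apply/ffunP => i; rewrite !ffunE.
- rewrite (_ : [ffun _ => _] = e) ?fK //.
  by apply/ffunP => i; rewrite ffunE.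
Qed.

End Generator.

Theorem proposition2p18 (R : comPzRingType) (M : lmodType R) :
  noetherian R -> generator M -> gives_NCCR M -> normal_ring R.
Proof.
move=> noethR /generator_split[tau [tauD tauZ tau1]].
move=> [_ _ _ [[_ cmA] gldimA]] p.
(* The depth condition concerns primes of the support. These are all primes: if [u] outside [q]
   kills the identity, applying [tau] gives [u = 0]. *)
have suppA q : supp (algmod (endo M)) q.
  exists (frac ((1 : endo M) : algmod _) (denom1 _)) => /frac_eq0[u /(congr1 tau)].
  rewrite tauZ tau1 mulr1 -[0 in RHS](scale0r 0) tauZ mul0r => u0.
  by apply: (prime_complE (s := u)); rewrite u0; apply: ideal0 (prime_ideal q).
have serreR (q : spec R) : serre_prime q.
  apply: (split_order_serre tauD tauZ tau1 noethR).
  (* Depth and global dimension both equal the Krull dimension of [ring_at q]. *)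
  by rewrite cmA ?gldimA.
have noeth_p : noetherian (ring_at p) by apply: loc_noetherian.
have serre_p (q : spec (ring_at p)) : serre_prime q.
  exact/serre_prime_loc/serreR.
apply: integrally_closed_domain_intro.
- exact: ring_at_neq0.
- exact: (serre_domain noeth_p (@ring_at_local _ p) serre_p).
- exact: (serre_integrally_closed noeth_p (@ring_at_local _ p) serre_p).
Qed.
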